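(* For $\operatorname{Re}\alpha=\operatorname{Re}\beta=0$ and $\operatorname{Im}\alpha=-\operatorname{Im}\beta=x\in\mathbb{R}$, the Euler beta function turns into a generalized function of $x$ and is expressed through the Dirac delta function: $$B(ix,-ix)=\lim_{\varepsilon\to 0+}B(\varepsilon+ix,\varepsilon-ix)=2\pi\,\delta(x),$$ where the limit is a weak limit. That is, for all real $A<B$ and every continuous function $\varphi$ on $[A,B]$, $$\lim_{\varepsilon\to0+}\int_A^B\varphi(x)\,B(\varepsilon+ix,\varepsilon-ix)\,dx=\begin{cases}2\pi\varphi(0), & 0\in(A,B),\\ 0, & 0\notin[A,B].\end{cases}$$
   Context: For $\operatorname{Re}\alpha>0$, $\operatorname{Re}\beta>0$ the Euler beta function is $B(\alpha,\beta)=\int_0^1 t^{\alpha-1}(1-t)^{\beta-1}\,dt=\dfrac{\Gamma(\alpha)\Gamma(\beta)}{\Gamma(\alpha+\beta)}$, with $\Gamma$ the Euler gamma function. The symbol $B(ix,-ix)$ denotes the generalized function defined by the weak limit of $B(\varepsilon+ix,\varepsilon-ix)$ as $\varepsilon\to0+$. The Dirac delta is the generalized function satisfying, for every continuous function $\varphi$ on $[A,B]$, $\int_A^B\varphi(x)\delta(x)\,dx=\varphi(0)$ if $0\in(A,B)$ and $=0$ if $0\notin[A,B]$. Equalities and limits of generalized functions are understood weakly, i.e. after integration against such $\varphi$. *)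

(* Defs.v *)
From Stdlib Require Import Reals.
From Coquelicot Require Import Coquelicot.

Open Scope R_scope.

Definition Cexp (z : C) : C :=
  (RtoC (exp (Re z)) * (cos (Im z), sin (Im z)))%C.

(* Meaningful for t > 0 only. *)
Definition Rpow_C (t : R) (z : C) : C := Cexp (z * RtoC (ln t))%C.

(* The integrand may be singular at both ends, so the integral is the improper
   Riemann integral over the open interval (0,1); it converges if Re a > 0 and
   Re b > 0. *)
Definition Beta (a b : C) : C :=
  @RInt_gen C_R_CompleteNormedModule
    (fun t : R => (Rpow_C t (a - 1) * Rpow_C (1 - t) (b - 1))%C)
    (at_right 0) (at_left 1).

(* A generalized function T is known through its pairings: T A B phi v reads
   "the integral of phi(x) T(x) over [A,B] is specified, with value v".
   It is a relation since a pairing may be left unspecified. *)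
Definition gen_fun : Type := R -> R -> (R -> C) -> C -> Prop.

(* Unspecified when 0 is an endpoint of [A,B]. *)
Definition dirac_delta : gen_fun := fun A B phi v =>
  (A < 0 < B /\ v = phi 0) \/ (~ (A <= 0 <= B) /\ v = RtoC 0).

Definition gf_scal (c : C) (T : gen_fun) : gen_fun := fun A B phi v =>
  exists w : C, T A B phi w /\ v = (c * w)%C.

Definition pairing (f : R -> C) (A B : R) (phi : R -> C) : C :=
  @RInt C_R_CompleteNormedModule (fun x : R => (phi x * f x)%C) A B.

(* The weak limit of f eps as eps -> 0+. Since RInt is total, integrability is
   required separately. *)
Definition weak_lim (f : R -> R -> C) : gen_fun := fun A B phi v =>
  (forall eps : R, 0 < eps ->
    @ex_RInt C_R_NormedModule (fun x : R => (phi x * f eps x)%C) A B) /\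
  filterlim (fun eps : R => pairing (f eps) A B phi)
    (at_right 0) (@locally C_UniformSpace v).

Definition continuous_on_segment (A B : R) (phi : R -> C) : Prop :=
  @continuous_on R_UniformSpace C_UniformSpace (fun x => A <= x <= B) phi.

(* Weak equality. Segments having 0 as an endpoint are not tested, because the
   pairing with the delta function is not specified there. *)
Definition gf_eq (S T : gen_fun) : Prop :=
  forall (A B : R) (phi : R -> C), A < B -> A <> 0 -> B <> 0 ->
    continuous_on_segment A B phi ->
    forall v : C, S A B phi v <-> T A B phi v.

Definition Beta_near_imag (eps x : R) : C :=
  Beta (RtoC eps + Ci * RtoC x)%C (RtoC eps - Ci * RtoC x)%C.

(* The generalized function B(ix,-ix). *)
Definition Beta_imag : gen_fun := weak_lim Beta_near_imag.

(* Main.v *)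
Require Import Defs.
From Stdlib Require Import Reals Lra.
From Coquelicot Require Import Coquelicot.

Open Scope R_scope.

(** Why [B (eps + ix, eps - ix)] tends to [2 pi delta (x)].

    With [a = eps + ix] and [b = eps - ix], two integrations by parts raise
    both arguments by 2 and put all of the singularity into a rational factor:
    [B (a, b) = a_1 a_2 B (a + 2, b + 2)], where
    [a_1 = 2 eps (2 eps + 1) / (eps^2 + x^2)] and [a_2] is the same expression
    with [1 + eps] for [eps] ([Beta_near_imag_shifted]).  Hence
    [B (a, b)] is the Poisson kernel [2 eps / (eps^2 + x^2)] times a cofactor
    ([Beta_near_imag_poisson]).

    The cofactor is harmless: [B (a + 2, b + 2)] is the integral over
    [[0, 1]] of [t (1 - t) . t^a (1 - t)^b], whose integrand is Lipschitz in
    [(eps, x)] uniformly in [t], up to [eps = 0], because [t (1 - t)] absorbs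
    the logarithms ([shifted_kernel_lipschitz]).  So the cofactor is bounded,
    continuous in [x], and tends to [3! B (2, 2) = 1] at [(0, 0)]
    ([poisson_cofactor_lim]).

    The Poisson kernel has mass tending to [2 pi] on a segment around 0, and
    its product with [x^2] is at most [2 eps].  A bound
    [|F x - c| <= eta + L x^2] on a segment therefore gives
    [|int P F - c int P| <= 2 pi eta + 2 eps L (B - A)] without cutting the
    segment ([poisson_integral_estimate]).  Both cases of the theorem follow:
    near 0 the term [eta] comes from continuity and [L x^2] covers the rest;
    away from 0 one takes [c = 0] and [eta = 0]. *)

(** * Limits of complex-valued functions *)

Lemma norm_C_R (z : C) : norm (z : C_R_NormedModule) = Cmod z.
Proof.
  unfold Cmod. rewrite <- (pow2_abs (fst z)), <- (pow2_abs (snd z)). reflexivity.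
Qed.

Lemma filterlim_Cmod {T : Type} {F : (T -> Prop) -> Prop} {FF : Filter F}
    (f : T -> C) (l : C) :
  filterlim f F (@locally C_UniformSpace l) <->
  forall eta : R, 0 < eta -> F (fun t => Cmod (f t - l)%C < eta).
Proof.
  pose proof (@filterlim_locally_ball_norm R_AbsRing T C_R_NormedModule F FF f l) as E.
  split.
  - intros H eta He. generalize (proj1 E H (mkposreal eta He)). apply filter_imp; intros t Ht.
    unfold ball_norm in Ht; rewrite norm_C_R in Ht. exact Ht.
  - intros H. apply (proj2 E). intros eta. generalize (H eta (cond_pos eta)).
    apply filter_imp; intros t Ht. unfold ball_norm; rewrite norm_C_R. exact Ht.
Qed.

(** * Functions continuous on a segment *)

(** The nearest point of the segment: composing with it extends a function
    that is continuous on [[a, b]] only to a function continuous everywhere, so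
    that total-function lemmas on integrals apply. *)
Definition clamp (a b x : R) : R := Rmax a (Rmin b x).

Lemma clamp_in (a b x : R) : a <= b -> a <= clamp a b x <= b.
Proof.
  intros H; unfold clamp; unfold Rmax, Rmin.
  repeat destruct Rle_dec; lra.
Qed.

Lemma clamp_id (a b x : R) : a <= x <= b -> clamp a b x = x.
Proof.
  intros H; unfold clamp; unfold Rmax, Rmin.
  repeat destruct Rle_dec; lra.
Qed.

Lemma clamp_dist (a b x y : R) : Rabs (clamp a b x - clamp a b y) <= Rabs (x - y).
Proof.
  unfold clamp, Rmax, Rmin, Rabs.
  repeat destruct Rle_dec; repeat destruct Rcase_abs; lra.
Qed.

Lemma continuous_clamp (A B : R) (f : R -> C) : A <= B -> continuous_on_segment A B f ->
  forall x, @continuous R_UniformSpace C_UniformSpace (fun y => f (clamp A B y)) x.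
Proof.
  intros AB Hf x.
  unfold continuous.
  apply (filterlim_comp _ _ _ (clamp A B) f (locally x)
    (within (fun x => A <= x <= B) (locally (clamp A B x)))).
  2: { apply Hf; apply clamp_in; exact AB. }
  intros P [d HP]. exists d. intros y Hy. apply HP.
  - apply Rle_lt_trans with (2 := Hy). apply clamp_dist.
  - apply clamp_in; exact AB.
Qed.

Lemma ex_RInt_segment (A B : R) (f : R -> C) : A <= B -> continuous_on_segment A B f ->
  @ex_RInt C_R_NormedModule f A B.
Proof.
  intros AB Hf.
  apply (@ex_RInt_ext C_R_NormedModule (fun y => f (clamp A B y))).
  - rewrite Rmin_left, Rmax_right by assumption. intros x Hx. rewrite clamp_id; [reflexivity|lra].
  - apply (@ex_RInt_continuous C_R_CompleteNormedModule). intros z _.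
    exact (continuous_clamp A B f AB Hf z).
Qed.

(** The second fundamental theorem for improper integrals with values in a
    normed module; the primitive need only have limits at the two ends. *)
Lemma is_RInt_gen_primitive {V : NormedModule R_AbsRing}
    {Fa Fb : (R -> Prop) -> Prop} {FFa : Filter Fa} {FFb : Filter Fb}
    (f H : R -> V) (la lb : V) :
  filter_prod Fa Fb
    (fun ab => is_RInt f (fst ab) (snd ab) (minus (H (snd ab)) (H (fst ab)))) ->
  filterlim H Fa (locally la) -> filterlim H Fb (locally lb) ->
  is_RInt_gen f Fa Fb (minus lb la).
Proof.
  intros Hf Ha Hb P HP.
  assert (L : filterlim (fun ab : R * R => minus (H (snd ab)) (H (fst ab)))
     (filter_prod Fa Fb) (locally (minus lb la))).
  { apply (filterlim_comp_2 (F := filter_prod Fa Fb)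
       (fun ab => H (snd ab)) (fun ab => opp (H (fst ab))) plus) with
       (2 := filterlim_comp _ _ _ _ _ _ _ _
           (filterlim_comp _ _ _ _ _ _ _ _ filterlim_fst Ha) (filterlim_opp la))
       (3 := filterlim_plus lb (opp la)).
    exact (filterlim_comp _ _ _ _ _ _ _ _ filterlim_snd Hb). }
  specialize (L P HP). unfold filtermap in L. unfold filtermapi.
  generalize (filter_and _ _ Hf L). apply filter_imp.
  intros ab [H1 H2]. eexists; split; [exact H1|exact H2].
Qed.

Lemma filter_prod_open_interval (A B : R) : A < B ->
  filter_prod (at_right A) (at_left B)
    (fun ab => A < fst ab < B /\ A < snd ab < B).
Proof.
  intros AB.
  assert (HAB : 0 < B - A) by lra.
  exists (fun x => A < x < B) (fun x => A < x < B); [| |simpl; auto];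
  exists (mkposreal _ HAB); intros y Hy Hy';
  apply Rabs_lt_between' in Hy; simpl in Hy; lra.
Qed.

(** An improper integral over the open segment is the proper one when the
    integrand extends continuously to the ends: the indefinite integral of the
    clamped integrand is a primitive continuous at both ends. *)
Lemma is_RInt_gen_segment (A B : R) (f : R -> C) : A < B -> continuous_on_segment A B f ->
  @is_RInt_gen C_R_NormedModule f (at_right A) (at_left B)
    (@RInt C_R_CompleteNormedModule f A B).
Proof.
  intros AB Hf. pose (g := fun y => f (clamp A B y)).
  assert (Cg : forall x, @continuous R_UniformSpace C_R_NormedModule g x).
  { intros x; exact (continuous_clamp A B f (Rlt_le _ _ AB) Hf x). }
  assert (Ig : forall u v, @is_RInt C_R_NormedModule g u v (@RInt C_R_CompleteNormedModule g u v)).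
  { intros u v. apply (@RInt_correct C_R_CompleteNormedModule).
    apply (@ex_RInt_continuous C_R_CompleteNormedModule). intros z _; apply Cg. }
  assert (Efg : @RInt C_R_CompleteNormedModule f A B = @RInt C_R_CompleteNormedModule g A B).
  { apply (@RInt_ext C_R_CompleteNormedModule). rewrite Rmin_left, Rmax_right by lra.
    intros x Hx. unfold g. rewrite clamp_id; [reflexivity|lra]. }
  rewrite Efg.
  apply (@is_RInt_gen_ext C_R_NormedModule _ _ _ _ g).
  { generalize (filter_prod_open_interval A B AB). apply filter_imp. intros [u v] [Hu Hv] x Hx. simpl in *. unfold g.
    rewrite clamp_id; [reflexivity|].
    revert Hx; unfold Rmin, Rmax; destruct Rle_dec; lra. }
  replace (@RInt C_R_CompleteNormedModule g A B) with
    (minus (@RInt C_R_CompleteNormedModule g A B) (@RInt C_R_CompleteNormedModule g A A)).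
  2: { rewrite RInt_point. exact (@minus_zero_r C_R_NormedModule _). }
  assert (CH : forall z, @continuous R_UniformSpace C_R_NormedModule
      (fun y => @RInt C_R_CompleteNormedModule g A y) z).
  { intros z. apply (@continuous_RInt_1 C_R_NormedModule g A z).
    apply filter_forall. intros y; apply Ig. }
  apply (is_RInt_gen_primitive (V := C_R_NormedModule) g (fun y => @RInt C_R_CompleteNormedModule g A y)).
  - apply filter_forall. intros [u v]. simpl.
    unfold minus. rewrite plus_comm.
    apply (@is_RInt_Chasles C_R_NormedModule) with A; [|apply Ig].
    apply (@is_RInt_swap C_R_NormedModule). apply Ig.
  - refine (filterlim_filter_le_1 _ _ (CH A)). apply filter_le_within.
  - refine (filterlim_filter_le_1 _ _ (CH B)). apply filter_le_within.
Qed.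

Lemma filterlim_pair_C {T : Type} {F : (T -> Prop) -> Prop} {FF : Filter F}
    (f g : T -> R) (a b : R) :
  filterlim f F (locally a) -> filterlim g F (locally b) ->
  filterlim (fun t => (f t, g t)) F (@locally C_UniformSpace (a, b)).
Proof.
  intros Hf Hg P [d HP].
  assert (Hf' : F (fun t => ball a d (f t))) by exact (Hf _ (locally_ball a d)).
  assert (Hg' : F (fun t => ball b d (g t))) by exact (Hg _ (locally_ball b d)).
  generalize (filter_and _ _ Hf' Hg').
  unfold filtermap. apply filter_imp. intros t [H1 H2]. apply HP. split; assumption.
Qed.

(** * Raising both arguments of the beta function *)

(** [t^(s + ix) (1 - t)^(s - ix)] in polar form. *)
Definition beta_kernel (s x t : R) : C :=
  (exp (s * (ln t + ln (1 - t))) * cos (x * (ln t - ln (1 - t))),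
   exp (s * (ln t + ln (1 - t))) * sin (x * (ln t - ln (1 - t)))).

Lemma Rpow_C_pair (t a b : R) :
  Rpow_C t (a, b) = (exp (a * ln t) * cos (b * ln t), exp (a * ln t) * sin (b * ln t)).
Proof.
  unfold Rpow_C, Cexp, Re, Im, RtoC, Cmult; simpl.
  replace (a * ln t - b * 0) with (a * ln t) by ring.
  replace (a * 0 + b * ln t) with (b * ln t) by ring.
  f_equal; ring.
Qed.

Lemma Rpow_C_mult_conj (eps x t : R) :
  (Rpow_C t (RtoC eps + Ci * RtoC x - 1) * Rpow_C (1 - t) (RtoC eps - Ci * RtoC x - 1))%C
  = beta_kernel (eps - 1) x t.
Proof.
  replace (RtoC eps + Ci * RtoC x - 1)%C with (eps - 1, x)
    by (apply injective_projections; simpl; ring).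
  replace (RtoC eps - Ci * RtoC x - 1)%C with (eps - 1, - x)
    by (apply injective_projections; simpl; ring).
  rewrite !Rpow_C_pair. unfold beta_kernel.
  replace ((eps - 1) * (ln t + ln (1 - t)))
    with ((eps - 1) * ln t + (eps - 1) * ln (1 - t)) by ring.
  replace (x * (ln t - ln (1 - t))) with (x * ln t + - x * ln (1 - t)) by ring.
  rewrite exp_plus, cos_plus, sin_plus.
  unfold Cmult; simpl. f_equal; ring.
Qed.

Lemma beta_kernel_S (s x t : R) : 0 < t < 1 ->
  beta_kernel (s + 1) x t = (RtoC (t * (1 - t)) * beta_kernel s x t)%C.
Proof.
  intros [H0 H1]. unfold beta_kernel.
  replace ((s + 1) * (ln t + ln (1 - t))) with (s * (ln t + ln (1 - t)) + (ln t + ln (1 - t))) by ring.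
  rewrite (exp_plus (s * _)), (exp_plus (ln t)), !exp_ln by lra.
  unfold RtoC, Cmult; simpl. f_equal; ring.
Qed.

(** [t^a (1 - t)^b (b - 2 s t) / (a b)] with [a = s + ix] and [b = s - ix]:
    the multiple of [t^a (1 - t)^b] by a polynomial of degree 1 whose derivative
    is [t^(a - 1) (1 - t)^(b - 1) (1 - K t (1 - t))] for a constant [K], namely
    [K = raise_factor s x]. Two coefficients of the polynomial and [K] are fixed
    by comparing the three coefficients of [1 - K t (1 - t)]. *)
Definition beta_primitive (s x t : R) : C :=
  (exp (s * (ln t + ln (1 - t))) *
     (s * (1 - 2 * t) * cos (x * (ln t - ln (1 - t))) + x * sin (x * (ln t - ln (1 - t))))
     / (s ^ 2 + x ^ 2),
   exp (s * (ln t + ln (1 - t))) *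
     (s * (1 - 2 * t) * sin (x * (ln t - ln (1 - t))) - x * cos (x * (ln t - ln (1 - t))))
     / (s ^ 2 + x ^ 2)).

(** [(a + b) (a + b + 1) / (a b)] for [a = s + ix] and [b = s - ix], the
    quotient of [B (a, b)] by [B (a + 1, b + 1)]. *)
Definition raise_factor (s x : R) : R := 2 * s * (2 * s + 1) / (s ^ 2 + x ^ 2).

Lemma exp_shift (s t : R) : 0 < t < 1 ->
  exp ((s - 1) * (ln t + ln (1 - t))) = exp (s * (ln t + ln (1 - t))) / (t * (1 - t)).
Proof.
  intros Ht.
  replace ((s - 1) * (ln t + ln (1 - t))) with (s * (ln t + ln (1 - t)) - (ln t + ln (1 - t))) by ring.
  unfold Rminus at 1. rewrite exp_plus, exp_Ropp, exp_plus, !exp_ln by lra.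
  reflexivity.
Qed.

Lemma is_RInt_beta_primitive (s x u v : R) : 0 < s -> 0 < u < 1 -> 0 < v < 1 ->
  @is_RInt C_R_NormedModule
    (fun t => minus (beta_kernel (s - 1) x t) (scal (raise_factor s x) (beta_kernel s x t)) : C_R_NormedModule)
    u v (minus (beta_primitive s x v) (beta_primitive s x u)).
Proof.
  intros Hs Hu Hv.
  assert (HD : s ^ 2 + x ^ 2 <> 0) by nra.
  assert (Hin : forall t, Rmin u v <= t <= Rmax u v -> 0 < t < 1).
  { intros t. unfold Rmin, Rmax; destruct Rle_dec; lra. }
  apply is_RInt_fct_extend_pair.
  - apply (is_RInt_derive (fun t => fst (beta_primitive s x t))).
    + intros t Ht. apply Hin in Ht. cbn [fst beta_primitive beta_kernel minus plus opp scal].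
      auto_derive; [lra|]. simpl. unfold scal; simpl. unfold mult, plus, opp; simpl.
      rewrite exp_shift by lra. unfold raise_factor. unfold Rminus. field. lra.
    + intros t Ht. apply Hin in Ht. apply (ex_derive_continuous (K := R_AbsRing) (V := R_NormedModule)).
      simpl. unfold scal, plus, opp; simpl. unfold mult; simpl.
      auto_derive. lra.
  - apply (is_RInt_derive (fun t => snd (beta_primitive s x t))).
    + intros t Ht. apply Hin in Ht. cbn [snd beta_primitive beta_kernel minus plus opp scal].
      auto_derive; [lra|]. simpl. unfold scal; simpl. unfold mult, plus, opp; simpl.
      rewrite exp_shift by lra. unfold raise_factor. unfold Rminus. field. lra.
    + intros t Ht. apply Hin in Ht. apply (ex_derive_continuous (K := R_AbsRing) (V := R_NormedModule)).
      simpl. unfold scal, plus, opp; simpl. unfold mult; simpl.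
      auto_derive. lra.
Qed.

Lemma Cmod_le_sum (a b : R) : Cmod (a, b) <= Rabs a + Rabs b.
Proof.
  pose proof (Rabs_pos a); pose proof (Rabs_pos b).
  unfold Cmod; simpl fst; simpl snd. rewrite <- (pow2_abs a), <- (pow2_abs b).
  rewrite <- (sqrt_pow2 (Rabs a + Rabs b)) by lra.
  apply sqrt_le_1; nra.
Qed.

Lemma Rabs_cos_le (y : R) : Rabs (cos y) <= 1.
Proof. apply Rabs_le. pose proof (COS_bound y). lra. Qed.

Lemma Rabs_sin_le (y : R) : Rabs (sin y) <= 1.
Proof. apply Rabs_le. pose proof (SIN_bound y). lra. Qed.

Lemma exp_le_exp (p q : R) : p <= q -> exp p <= exp q.
Proof.
  intros [H|H]; [left; apply exp_increasing; exact H|subst; apply Rle_refl].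
Qed.

Lemma ln_le_0 (t : R) : 0 < t <= 1 -> ln t <= 0.
Proof.
  intros [H0 H1]. rewrite <- ln_1. destruct H1 as [H1|H1].
  - left; apply ln_increasing; assumption.
  - subst; lra.
Qed.

Lemma beta_primitive_bound (s x t : R) : 0 < s -> 0 < t < 1 ->
  Cmod (beta_primitive s x t) <=
  exp (s * (ln t + ln (1 - t))) * (2 * (s + Rabs x) / (s ^ 2 + x ^ 2)).
Proof.
  intros Hs Ht. unfold beta_primitive. eapply Rle_trans; [apply Cmod_le_sum|].
  assert (HD : 0 < s ^ 2 + x ^ 2) by nra.
  pose proof (exp_pos (s * (ln t + ln (1 - t)))) as HU.
  set (U := exp _) in *. set (th := x * _).
  pose proof (Rabs_cos_le th) as Hc. pose proof (Rabs_sin_le th) as Hsn.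
  pose proof (Rabs_pos (cos th)) as Hc0. pose proof (Rabs_pos (sin th)) as Hs0.
  pose proof (Rabs_pos x) as Hx0.
  unfold Rdiv. rewrite !Rabs_mult, (Rabs_right U), (Rabs_right (/ _)) by
    (try (left; apply Rinv_0_lt_compat; assumption); lra).
  assert (Hst : Rabs (s * (1 - 2 * t)) <= s) by (apply Rabs_le; nra).
  assert (H1 : Rabs (s * (1 - 2 * t) * cos th + x * sin th) <= s + Rabs x).
  { eapply Rle_trans; [apply Rabs_triang|]. rewrite (Rabs_mult _ (cos th)), (Rabs_mult x).
    pose proof (Rabs_pos (s * (1 - 2 * t))). nra. }
  assert (H2 : Rabs (s * (1 - 2 * t) * sin th - x * cos th) <= s + Rabs x).
  { eapply Rle_trans; [apply Rabs_triang|].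
    rewrite Rabs_Ropp, (Rabs_mult _ (sin th)), (Rabs_mult x).
    pose proof (Rabs_pos (s * (1 - 2 * t))). nra. }
  pose proof (Rinv_0_lt_compat _ HD).
  revert H1 H2. generalize (Rabs (s * (1 - 2 * t) * cos th + x * sin th)).
  generalize (Rabs (s * (1 - 2 * t) * sin th - x * cos th)). intros b a Ha Hb.
  rewrite !Rmult_assoc, <- Rmult_plus_distr_l.
  apply Rmult_le_compat_l; [lra|]. nra.
Qed.

Lemma exp_mult_ln_small (s eta : R) : 0 < s -> 0 < eta ->
  exists d : posreal, forall t, 0 < t < d -> exp (s * ln t) < eta.
Proof.
  intros Hs He. exists (mkposreal _ (exp_pos (ln eta / s))). simpl. intros t [H0 H1].
  rewrite <- (exp_ln eta) at 1 by assumption. apply exp_increasing.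
  apply ln_increasing in H1; [|assumption]. rewrite ln_exp in H1.
  apply Rmult_lt_compat_l with (r := s) in H1; [|assumption].
  replace (s * (ln eta / s)) with (ln eta) in H1 by (field; lra). exact H1.
Qed.

(** The modulus is at most a constant times [(t (1 - t))^s], and [s > 0]. *)
Lemma beta_primitive_lim (s x : R) : 0 < s ->
  filterlim (beta_primitive s x) (at_right 0) (@locally C_UniformSpace (RtoC 0)) /\
  filterlim (beta_primitive s x) (at_left 1) (@locally C_UniformSpace (RtoC 0)).
Proof.
  intros Hs.
  assert (HD : 0 < s ^ 2 + x ^ 2) by nra.
  assert (HM : 0 < 2 * (s + Rabs x) / (s ^ 2 + x ^ 2)).
  { pose proof (Rabs_pos x). apply Rdiv_lt_0_compat; lra. }
  set (M := 2 * (s + Rabs x) / (s ^ 2 + x ^ 2)) in *.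
  assert (key : forall eta, 0 < eta -> exists d : posreal, forall t, 0 < t < 1 ->
     (t < d \/ 1 - t < d) -> Cmod (beta_primitive s x t - RtoC 0)%C < eta).
  { intros eta He.
    destruct (exp_mult_ln_small s (eta / M) Hs) as [d Hd]; [apply Rdiv_lt_0_compat; lra|].
    exists d. intros t Ht Htd.
    replace (beta_primitive s x t - RtoC 0)%C with (beta_primitive s x t) by ring.
    eapply Rle_lt_trans; [apply beta_primitive_bound; assumption|]. fold M.
    replace eta with (eta / M * M) by (field; lra).
    apply Rmult_lt_compat_r; [exact HM|].
    pose proof (ln_le_0 t) as L0. pose proof (ln_le_0 (1 - t)) as L1.
    destruct Htd as [Htd|Htd].
    - apply Rle_lt_trans with (2 := Hd t (conj (proj1 Ht) Htd)). apply exp_le_exp. nra.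
    - assert (Hp : 0 < 1 - t < d) by lra.
      apply Rle_lt_trans with (2 := Hd _ Hp). apply exp_le_exp. nra. }
  split; apply filterlim_Cmod; intros eta He; destruct (key eta He) as [d Hd].
  - assert (Hm : 0 < Rmin d 1) by (apply Rmin_pos; [apply cond_pos|lra]).
    exists (mkposreal _ Hm). intros t Ht Ht0. apply Rabs_lt_between' in Ht. simpl in Ht.
    pose proof (Rmin_l d 1). pose proof (Rmin_r d 1).
    apply Hd; [lra|left; lra].
  - assert (Hm : 0 < Rmin d 1) by (apply Rmin_pos; [apply cond_pos|lra]).
    exists (mkposreal _ Hm). intros t Ht Ht0. apply Rabs_lt_between' in Ht. simpl in Ht.
    pose proof (Rmin_l d 1). pose proof (Rmin_r d 1).
    apply Hd; [lra|right; lra].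
Qed.

(** Integration by parts in the form
    [B (a, b) = K B (a + 1, b + 1)]: the integral of the derivative of
    [beta_primitive] is 0, since that function vanishes at both ends.
    Convergence of the left-hand integral is part of the conclusion. *)
Lemma beta_kernel_raise (s x : R) (v : C) : 0 < s ->
  @is_RInt_gen C_R_NormedModule (beta_kernel s x) (at_right 0) (at_left 1) v ->
  @is_RInt_gen C_R_NormedModule (beta_kernel (s - 1) x) (at_right 0) (at_left 1)
    (RtoC (raise_factor s x) * v)%C.
Proof.
  intros Hs Hv. destruct (beta_primitive_lim s x Hs) as [L0 L1].
  assert (HP : @is_RInt_gen C_R_NormedModule
     (fun t => minus (beta_kernel (s - 1) x t) (scal (raise_factor s x) (beta_kernel s x t)) : C_R_NormedModule)
     (at_right 0) (at_left 1) (minus (RtoC 0) (RtoC 0))).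
  { apply (is_RInt_gen_primitive (V := C_R_NormedModule)) with (beta_primitive s x); [|exact L0|exact L1].
    generalize (filter_prod_open_interval 0 1 Rlt_0_1). apply filter_imp. intros [u w] [Hu Hw].
    apply is_RInt_beta_primitive; assumption. }
  pose proof (is_RInt_gen_plus _ _ _ _ HP (is_RInt_gen_scal _ (raise_factor s x) _ Hv)) as HS.
  replace (RtoC (raise_factor s x) * v)%C with
    (@plus C_R_NormedModule (minus (RtoC 0) (RtoC 0)) (scal (raise_factor s x) v)).
  2: { rewrite scal_R_Cmult. apply injective_projections; simpl; unfold plus, opp; simpl; ring. }
  revert HS. apply is_RInt_gen_ext. apply filter_forall. intros ab t _.
  generalize (beta_kernel (s - 1) x t) (beta_kernel s x t). intros z w.
  apply injective_projections; simpl; unfold minus, plus, opp, scal; simpl;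
    unfold plus, opp, mult; simpl; ring.
Qed.

(** * The beta function with raised arguments *)

Lemma Rabs_cos_minus (a b : R) : Rabs (cos a - cos b) <= Rabs (a - b).
Proof.
  destruct (MVT_abs cos (fun y => - sin y) b a) as [c [Hc _]].
  { intros c _. apply derivable_pt_lim_cos. }
  rewrite Hc, Rabs_Ropp. pose proof (Rabs_sin_le c). pose proof (Rabs_pos (a - b)). nra.
Qed.

Lemma Rabs_sin_minus (a b : R) : Rabs (sin a - sin b) <= Rabs (a - b).
Proof.
  destruct (MVT_abs sin cos b a) as [c [Hc _]].
  { intros c _. apply derivable_pt_lim_sin. }
  rewrite Hc. pose proof (Rabs_cos_le c). pose proof (Rabs_pos (a - b)). nra.
Qed.

(** The derivative of [exp] is at most 1 on the negative half-line. *)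
Lemma exp_minus_le (p q : R) : p <= 0 -> q <= 0 -> Rabs (exp p - exp q) <= Rabs (p - q).
Proof.
  assert (W : forall u v, u <= v -> v <= 0 -> exp v - exp u <= v - u).
  { intros u v Huv Hv.
    pose proof (exp_ineq1_le (u - v)). pose proof (exp_le_exp v 0 Hv) as E0. rewrite exp_0 in E0.
    pose proof (exp_pos v).
    replace (exp u) with (exp v * exp (u - v)) by (rewrite <- exp_plus; f_equal; ring).
    nra. }
  intros Hp Hq. destruct (Rle_dec p q) as [H|H].
  - pose proof (exp_le_exp _ _ H). rewrite (Rabs_left1 (exp p - _)), Rabs_left1 by lra.
    pose proof (W p q H Hq). lra.
  - assert (H' : q <= p) by lra. pose proof (exp_le_exp _ _ H').
    rewrite (Rabs_right (exp p - _)), Rabs_right by lra. apply W; lra.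
Qed.

Lemma polar_lipschitz (p q a b : R) : p <= 0 -> q <= 0 ->
  Cmod (Cminus (exp p * cos a, exp p * sin a) (exp q * cos b, exp q * sin b))
  <= 2 * (Rabs (p - q) + Rabs (a - b)).
Proof.
  intros Hp Hq. unfold Cminus, Cplus, Copp; simpl. eapply Rle_trans; [apply Cmod_le_sum|].
  pose proof (exp_minus_le p q Hp Hq) as HE.
  pose proof (exp_le_exp _ _ Hp) as E1. rewrite exp_0 in E1. pose proof (exp_pos p).
  assert (W : forall u v, Rabs v <= 1 -> Rabs (u - v) <= Rabs (a - b) ->
    Rabs (exp p * u + - (exp q * v)) <= Rabs (p - q) + Rabs (a - b)).
  { intros u v Hv Huv.
    replace (exp p * u + - (exp q * v)) with (exp p * (u - v) + (exp p - exp q) * v) by ring.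
    eapply Rle_trans; [apply Rabs_triang|]. rewrite !Rabs_mult, (Rabs_right (exp p)) by lra.
    pose proof (Rabs_pos (u - v)). pose proof (Rabs_pos v). pose proof (Rabs_pos (exp p - exp q)).
    nra. }
  pose proof (W _ _ (Rabs_cos_le b) (Rabs_cos_minus a b)).
  pose proof (W _ _ (Rabs_sin_le b) (Rabs_sin_minus a b)). lra.
Qed.

(** From [- u ln u <= 1 - u] at [u = t] and [u = 1 - t], the left side is at
    most [(1 - t)^2 + t^2]. *)
Lemma mult_ln_bound (t : R) : 0 <= t <= 1 -> t * (1 - t) * (- ln t - ln (1 - t)) <= 1.
Proof.
  intros Ht.
  destruct (Req_dec t 0) as [->|H0]; [lra|]. destruct (Req_dec t 1) as [->|H1]; [lra|].
  assert (W : forall u, 0 < u -> u * - ln u <= 1 - u).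
  { intros u Hu. pose proof (exp_ineq1_le (- ln u)) as E.
    rewrite exp_Ropp, exp_ln in E by assumption.
    apply Rmult_le_compat_l with (r := u) in E; [|lra]. rewrite Rinv_r in E; lra. }
  pose proof (W t ltac:(lra)) as A. pose proof (W (1 - t) ltac:(lra)) as B.
  apply Rmult_le_compat_l with (r := 1 - t) in A; [|lra].
  apply Rmult_le_compat_l with (r := t) in B; [|lra].
  assert (0 <= t * (1 - t)) by (apply Rmult_le_pos; lra). lra.
Qed.

(** At the ends this uses that [ln 0 = 0]. *)
Lemma ln_unit_interval (t : R) : 0 <= t <= 1 -> ln t <= 0 /\ ln (1 - t) <= 0.
Proof.
  assert (W : forall u, 0 <= u <= 1 -> ln u <= 0).
  { intros u Hu. destruct (Req_dec u 0) as [->|H].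
    - unfold ln. destruct Rlt_dec as [C|C]; [exfalso; exact (Rlt_irrefl 0 C)|lra].
    - apply ln_le_0; lra. }
  intros Ht; split; apply W; lra.
Qed.

(** On the open interval this is [beta_kernel (s + 1) x]. The factor
    [t (1 - t)] is kept apart because it makes the value 0 at the ends, where
    [beta_kernel] has the spurious value 1, because [ln 0 = 0]. *)
Definition shifted_kernel (s x t : R) : C := (RtoC (t * (1 - t)) * beta_kernel s x t)%C.

(** The exponent and the phase are linear in [s] and [x] with slopes
    [ln t + ln (1 - t)] and [ln t - ln (1 - t)], both at most
    [1 / (t (1 - t))] in absolute value. *)
Lemma shifted_kernel_lipschitz (s s' x y t : R) : 0 <= s -> 0 <= s' -> 0 <= t <= 1 ->
  Cmod (shifted_kernel s x t - shifted_kernel s' y t)%C <= 2 * (Rabs (s - s') + Rabs (x - y)).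
Proof.
  intros Hs Hs' Ht. destruct (ln_unit_interval t Ht) as [L0 L1].
  pose proof (mult_ln_bound t Ht) as HL.
  unfold shifted_kernel.
  replace (_ - _)%C with (RtoC (t * (1 - t)) * (beta_kernel s x t - beta_kernel s' y t))%C by ring.
  rewrite Cmod_mult, Cmod_R, Rabs_right by nra.
  unfold beta_kernel.
  set (p := ln t) in *. set (q := ln (1 - t)) in *.
  pose proof (polar_lipschitz (s * (p + q)) (s' * (p + q)) (x * (p - q)) (y * (p - q))
    ltac:(nra) ltac:(nra)) as E.
  rewrite <- !Rmult_minus_distr_r, !Rabs_mult in E.
  rewrite (Rabs_left1 (p + q)) in E by lra.
  assert (Hpq : Rabs (p - q) <= - p - q) by (apply Rabs_le; lra).
  pose proof (Rabs_pos (s - s')). pose proof (Rabs_pos (x - y)).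
  assert (Ht0 : 0 <= t * (1 - t)) by nra.
  apply Rle_trans with (t * (1 - t) * (2 * ((Rabs (s - s') + Rabs (x - y)) * (- p - q)))).
  - apply Rmult_le_compat_l; [exact Ht0|]. nra.
  - nra.
Qed.

Lemma Cmod_beta_kernel_le (s x t : R) : 0 <= s -> 0 <= t <= 1 -> Cmod (beta_kernel s x t) <= 1.
Proof.
  intros Hs Ht. destruct (ln_unit_interval t Ht) as [L0 L1].
  unfold beta_kernel.
  replace (exp (s * (ln t + ln (1 - t))) * cos (x * (ln t - ln (1 - t))),
     exp (s * (ln t + ln (1 - t))) * sin (x * (ln t - ln (1 - t))))
   with (Cmult (RtoC (exp (s * (ln t + ln (1 - t)))))
     (cos (x * (ln t - ln (1 - t))), sin (x * (ln t - ln (1 - t)))))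
   by (apply injective_projections; simpl; ring).
  rewrite Cmod_mult, Cmod_R, Rabs_right by (left; apply exp_pos).
  replace (Cmod (cos _, sin _)) with 1.
  - rewrite Rmult_1_r. apply Rle_trans with (exp 0); [apply exp_le_exp; nra|].
    rewrite exp_0; lra.
  - unfold Cmod; simpl fst; simpl snd. rewrite <- !Rsqr_pow2, Rplus_comm, sin2_cos2, sqrt_1.
    reflexivity.
Qed.

Lemma Cmod_shifted_kernel_le (s x t : R) : 0 <= s -> 0 <= t <= 1 ->
  Cmod (shifted_kernel s x t) <= t * (1 - t).
Proof.
  intros Hs Ht.
  assert (H0 : 0 <= t * (1 - t)) by (apply Rmult_le_pos; lra).
  unfold shifted_kernel. rewrite Cmod_mult, Cmod_R, Rabs_right by lra.
  pose proof (Cmod_beta_kernel_le s x t Hs Ht). nra.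
Qed.

(** In the interior by differentiability, at the ends because the modulus is
    at most [t (1 - t)]. *)
Lemma shifted_kernel_continuous (s x : R) : 0 <= s -> continuous_on_segment 0 1 (shifted_kernel s x).
Proof.
  intros Hs t Ht.
  destruct (Req_dec (t * (1 - t)) 0) as [H0|H0].
  - apply filterlim_Cmod. intros eta He.
    assert (Hz : shifted_kernel s x t = RtoC 0).
    { unfold shifted_kernel. rewrite H0. ring. }
    rewrite Hz. exists (mkposreal eta He). intros u Hu Hu01.
    replace (shifted_kernel s x u - RtoC 0)%C with (shifted_kernel s x u) by ring.
    eapply Rle_lt_trans; [apply Cmod_shifted_kernel_le; assumption|].
    apply Rabs_lt_between' in Hu. simpl in Hu.
    assert (t = 0 \/ t = 1) as [-> | ->] by (destruct (Rmult_integral _ _ H0); [left|right]; lra);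
    nra.
  - assert (Hti : 0 < t < 1) by (split; apply Rnot_le_lt; intros C; apply H0; nra).
    apply (filterlim_filter_le_1 (shifted_kernel s x) (filter_le_within (F := locally t) _)).
    apply (filterlim_ext (fun u => (fst (shifted_kernel s x u), snd (shifted_kernel s x u)))).
    { intros u; symmetry; apply surjective_pairing. }
    rewrite (surjective_pairing (shifted_kernel s x t)).
    apply filterlim_pair_C.
    + apply (ex_derive_continuous (K := R_AbsRing) (V := R_NormedModule)
        (fun u => fst (shifted_kernel s x u))).
      simpl. auto_derive. lra.
    + apply (ex_derive_continuous (K := R_AbsRing) (V := R_NormedModule)
        (fun u => snd (shifted_kernel s x u))).
      simpl. auto_derive. lra.
Qed.

(** [B (s + 2 + ix, s + 2 - ix)], as a proper integral, defined also at
    [s = 0]. *)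
Definition shifted_beta (s x : R) : C := @RInt C_R_CompleteNormedModule (shifted_kernel s x) 0 1.

Lemma is_RInt_shifted_beta (s x : R) : 0 <= s ->
  @is_RInt C_R_NormedModule (shifted_kernel s x) 0 1 (shifted_beta s x).
Proof.
  intros Hs. apply (@RInt_correct C_R_CompleteNormedModule).
  apply ex_RInt_segment; [lra|]. apply shifted_kernel_continuous; exact Hs.
Qed.

(** Serves twice: with [s = s'] for continuity in [x], and with [s' = y = 0]
    for the limit at the origin. *)
Lemma shifted_beta_lipschitz (s s' x y : R) : 0 <= s -> 0 <= s' ->
  Cmod (shifted_beta s x - shifted_beta s' y)%C <= 2 * (Rabs (s - s') + Rabs (x - y)).
Proof.
  intros Hs Hs'.
  pose proof (is_RInt_minus _ _ _ _ _ _ (is_RInt_shifted_beta s x Hs) (is_RInt_shifted_beta s' y Hs')) as HI.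
  apply (norm_RInt_le_const (V := C_R_NormedModule) _ _ _ _ (2 * (Rabs (s - s') + Rabs (x - y)))) in HI;
    [|lra|].
  - rewrite norm_C_R in HI. eapply Rle_trans; [exact HI|]. lra.
  - intros t Ht. rewrite norm_C_R. apply shifted_kernel_lipschitz; assumption.
Qed.

Lemma Cmod_shifted_beta_le (s x : R) : 0 <= s -> Cmod (shifted_beta s x) <= 1.
Proof.
  intros Hs. pose proof (is_RInt_shifted_beta s x Hs) as HI.
  apply (norm_RInt_le_const (V := C_R_NormedModule) _ _ _ _ 1) in HI; [|lra|].
  - rewrite norm_C_R in HI. lra.
  - intros t Ht. rewrite norm_C_R. eapply Rle_trans; [apply Cmod_shifted_kernel_le; assumption|nra].
Qed.

(** [B (2, 2)], the integral of [t (1 - t)]. *)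
Lemma shifted_beta_0_0 : shifted_beta 0 0 = RtoC (1 / 6).
Proof.
  apply (@is_RInt_unique C_R_CompleteNormedModule).
  apply (@is_RInt_ext C_R_NormedModule (fun t => (t * (1 - t), 0))).
  { intros t _. unfold shifted_kernel, beta_kernel. rewrite !Rmult_0_l, exp_0, cos_0, sin_0.
    apply injective_projections; simpl; ring. }
  apply is_RInt_fct_extend_pair; simpl.
  - pose (F := fun t => t ^ 2 / 2 - t ^ 3 / 3).
    replace (1 / 6) with (minus (F 1) (F 0)) by (unfold F, minus, plus, opp; simpl; field).
    apply (is_RInt_derive F).
    + intros t _. unfold F. auto_derive; [exact I|]. field.
    + intros t _. apply (ex_derive_continuous (K := R_AbsRing) (V := R_NormedModule)).
      auto_derive. exact I.
  - pose proof (is_RInt_const (V := R_NormedModule) 0 1 0) as HC.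
    rewrite (scal_zero_r (V := R_ModuleSpace)) in HC. exact HC.
Qed.

Lemma Beta_near_imag_shifted (eps x : R) : 0 < eps ->
  Beta_near_imag eps x = (RtoC (raise_factor eps x * raise_factor (1 + eps) x) * shifted_beta eps x)%C.
Proof.
  intros He. unfold Beta_near_imag, Beta.
  apply (@is_RInt_gen_unique C_R_CompleteNormedModule); try typeclasses eauto.
  apply (@is_RInt_gen_ext C_R_NormedModule _ _ _ _ (beta_kernel (eps - 1) x)).
  { apply filter_forall. intros ab t _. symmetry. apply Rpow_C_mult_conj. }
  rewrite RtoC_mult, <- Cmult_assoc.
  apply beta_kernel_raise; [exact He|].
  replace eps with (1 + eps - 1) at 1 by ring.
  apply beta_kernel_raise; [lra|].
  apply (@is_RInt_gen_ext C_R_NormedModule _ _ _ _ (shifted_kernel eps x)).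
  { generalize (filter_prod_open_interval 0 1 Rlt_0_1). apply filter_imp. intros [u v] [Hu Hv] t Ht.
    simpl in *. unfold shifted_kernel. rewrite Rplus_comm. rewrite beta_kernel_S; [reflexivity|].
    revert Ht; unfold Rmin, Rmax; destruct Rle_dec; lra. }
  apply is_RInt_gen_segment; [lra|]. apply shifted_kernel_continuous; lra.
Qed.

(** * The Poisson kernel *)

Definition poisson (e x : R) : R := 2 * e / (e ^ 2 + x ^ 2).

Lemma poisson_pos (e x : R) : 0 < e -> 0 < poisson e x.
Proof. intros He. unfold poisson. apply Rdiv_lt_0_compat; nra. Qed.

Lemma poisson_mult_sq (e x : R) : 0 < e -> poisson e x * x ^ 2 <= 2 * e.
Proof.
  intros He. unfold poisson.
  assert (HD : 0 < e ^ 2 + x ^ 2) by nra.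
  apply Rmult_le_reg_r with (1 := HD).
  replace (2 * e / (e ^ 2 + x ^ 2) * x ^ 2 * (e ^ 2 + x ^ 2)) with (2 * e * x ^ 2) by (field; lra).
  nra.
Qed.

Lemma continuous_poisson (e x : R) : 0 < e -> continuous (poisson e) x.
Proof.
  intros He. apply (ex_derive_continuous (K := R_AbsRing) (V := R_NormedModule)).
  unfold poisson. auto_derive. nra.
Qed.

Definition poisson_mass (e A B : R) : R := 2 * (atan (B / e) - atan (A / e)).

Lemma is_RInt_poisson (e A B : R) : 0 < e ->
  is_RInt (poisson e) A B (poisson_mass e A B).
Proof.
  intros He.
  replace (poisson_mass e A B) with
    (minus ((fun x => 2 * atan (x / e)) B) ((fun x => 2 * atan (x / e)) A))
    by (unfold poisson_mass, minus, plus, opp; simpl; ring).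
  apply (is_RInt_derive (fun x => 2 * atan (x / e))).
  - intros x _. unfold poisson. auto_derive; [exact I|]. unfold Rsqr. field. split; nra.
  - intros x _. apply continuous_poisson; exact He.
Qed.

Lemma poisson_mass_le (e A B : R) : poisson_mass e A B <= 2 * PI.
Proof. unfold poisson_mass. pose proof (atan_bound (B / e)). pose proof (atan_bound (A / e)). lra. Qed.

(** [atan (B / e) = pi / 2 - atan (e / B)] for [B > 0], and likewise for
    [- A]; the right-hand sides are continuous at [e = 0]. *)
Lemma poisson_mass_lim (A B : R) : A < 0 < B ->
  filterlim (fun e => poisson_mass e A B) (at_right 0) (locally (2 * PI)).
Proof.
  intros [HA HB].
  apply (filterlim_ext_loc (fun e => 2 * (PI - atan (e / B) - atan (e / - A)))).
  { exists (mkposreal 1 Rlt_0_1). intros e _ He. unfold poisson_mass.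
    replace (B / e) with (/ (e / B)) by (field; lra).
    replace (A / e) with (- / (e / - A)) by (field; lra).
    rewrite atan_opp, !atan_inv by (apply Rdiv_lt_0_compat; lra). field. }
  apply (filterlim_filter_le_1 _ (filter_le_within (F := locally 0) _)).
  replace (2 * PI) with (2 * (PI - atan (0 / B) - atan (0 / - A))).
  - apply (ex_derive_continuous (K := R_AbsRing) (V := R_NormedModule)
      (fun e => 2 * (PI - atan (e / B) - atan (e / - A)))).
    auto_derive. exact I.
  - unfold Rdiv. rewrite !Rmult_0_l, atan_0. ring.
Qed.

Lemma filterlim_fst_C {T : Type} {F : (T -> Prop) -> Prop} {FF : Filter F} (f : T -> C) (a : C) :
  filterlim f F (@locally C_UniformSpace a) -> filterlim (fun t => fst (f t)) F (locally (fst a)).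
Proof.
  intros H P [d HP]. apply (H (fun z => P (fst z))). exists d. intros z [Hz _]. apply HP, Hz.
Qed.

Lemma filterlim_snd_C {T : Type} {F : (T -> Prop) -> Prop} {FF : Filter F} (f : T -> C) (a : C) :
  filterlim f F (@locally C_UniformSpace a) -> filterlim (fun t => snd (f t)) F (locally (snd a)).
Proof.
  intros H P [d HP]. apply (H (fun z => P (snd z))). exists d. intros z [_ Hz]. apply HP, Hz.
Qed.

Lemma filterlim_Rmult_fct {T : Type} {F : (T -> Prop) -> Prop} {FF : Filter F}
    (f g : T -> R) (a b : R) :
  filterlim f F (locally a) -> filterlim g F (locally b) ->
  filterlim (fun t => f t * g t) F (locally (a * b)).
Proof.
  intros Hf Hg. exact (filterlim_comp_2 f g Rmult Hf Hg (filterlim_mult (K := R_AbsRing) a b)).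
Qed.

Lemma filterlim_Rplus_fct {T : Type} {F : (T -> Prop) -> Prop} {FF : Filter F}
    (f g : T -> R) (a b : R) :
  filterlim f F (locally a) -> filterlim g F (locally b) ->
  filterlim (fun t => f t + g t) F (locally (a + b)).
Proof.
  intros Hf Hg. exact (filterlim_comp_2 f g Rplus Hf Hg (filterlim_plus (V := R_NormedModule) a b)).
Qed.

Lemma filterlim_Rminus_fct {T : Type} {F : (T -> Prop) -> Prop} {FF : Filter F}
    (f g : T -> R) (a b : R) :
  filterlim f F (locally a) -> filterlim g F (locally b) ->
  filterlim (fun t => f t - g t) F (locally (a - b)).
Proof.
  intros Hf Hg. apply (filterlim_Rplus_fct f (fun t => - g t)); [exact Hf|].
  exact (filterlim_comp _ _ _ g Ropp _ _ _ Hg (filterlim_opp (V := R_NormedModule) b)).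
Qed.

Lemma filterlim_Cmult_fct {T : Type} {F : (T -> Prop) -> Prop} {FF : Filter F}
    (f g : T -> C) (a b : C) :
  filterlim f F (@locally C_UniformSpace a) -> filterlim g F (@locally C_UniformSpace b) ->
  filterlim (fun t => f t * g t)%C F (@locally C_UniformSpace (a * b)%C).
Proof.
  intros Hf Hg.
  pose proof (filterlim_fst_C f a Hf). pose proof (filterlim_snd_C f a Hf).
  pose proof (filterlim_fst_C g b Hg). pose proof (filterlim_snd_C g b Hg).
  unfold Cmult. apply filterlim_pair_C.
  - apply filterlim_Rminus_fct; apply filterlim_Rmult_fct; assumption.
  - apply filterlim_Rplus_fct; apply filterlim_Rmult_fct; assumption.
Qed.

Lemma filterlim_RtoC_fct {T : Type} {F : (T -> Prop) -> Prop} {FF : Filter F}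
    (f : T -> R) (a : R) :
  filterlim f F (locally a) ->
  filterlim (fun t => RtoC (f t)) F (@locally C_UniformSpace (RtoC a)).
Proof. intros Hf. apply filterlim_pair_C; [exact Hf|apply filterlim_const]. Qed.

(** Integrate [P |F - c| <= eta P + L x^2 P <= eta P + 2 e L], using that the
    mass of [P] is at most [2 pi]. *)
Lemma poisson_integral_estimate (e A B eta L : R) (F : R -> C) (c : C) :
  0 < e -> A <= B -> 0 <= eta -> 0 <= L ->
  (forall x, @continuous R_UniformSpace C_UniformSpace F x) ->
  (forall x, A <= x <= B -> Cmod (F x - c)%C <= eta + L * x ^ 2) ->
  Cmod (@RInt C_R_CompleteNormedModule (fun x => (RtoC (poisson e x) * F x)%C) A B
        - RtoC (poisson_mass e A B) * c)%C
  <= 2 * PI * eta + 2 * e * L * (B - A).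
Proof.
  intros He AB Heta HL CF HF.
  assert (I1 : @is_RInt C_R_NormedModule (fun x => (RtoC (poisson e x) * F x)%C) A B
     (@RInt C_R_CompleteNormedModule (fun x => (RtoC (poisson e x) * F x)%C) A B)).
  { apply (@RInt_correct C_R_CompleteNormedModule).
    apply (@ex_RInt_continuous C_R_CompleteNormedModule). intros x _.
    apply (filterlim_Cmult_fct (fun x => RtoC (poisson e x)) F); [|apply CF].
    apply filterlim_RtoC_fct. apply continuous_poisson; exact He. }
  assert (I2 : @is_RInt C_R_NormedModule (fun x => (RtoC (poisson e x) * c)%C) A B
     (RtoC (poisson_mass e A B) * c)%C).
  { pose proof (is_RInt_poisson e A B He) as HP. destruct c as [c1 c2].
    replace (RtoC (poisson_mass e A B) * (c1, c2))%C with
      (scal c1 (poisson_mass e A B), scal c2 (poisson_mass e A B))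
      by (apply injective_projections; simpl; unfold scal; simpl; unfold mult; simpl; ring).
    apply is_RInt_fct_extend_pair.
    - apply (is_RInt_ext (fun x => scal c1 (poisson e x))).
      + intros x _. simpl. unfold scal; simpl; unfold mult; simpl. ring.
      + apply (is_RInt_scal (V := R_NormedModule)), HP.
    - apply (is_RInt_ext (fun x => scal c2 (poisson e x))).
      + intros x _. simpl. unfold scal; simpl; unfold mult; simpl. ring.
      + apply (is_RInt_scal (V := R_NormedModule)), HP. }
  pose proof (is_RInt_minus _ _ _ _ _ _ I1 I2) as I3.
  pose proof (is_RInt_plus (V := R_NormedModule) _ _ _ _ _ _
    (is_RInt_scal (V := R_NormedModule) (poisson e) A B eta _ (is_RInt_poisson e A B He))
    (is_RInt_const (V := R_NormedModule) A B (2 * e * L))) as I4.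
  pose proof (fun H => norm_RInt_le (V := C_R_NormedModule) _ _ _ _ _ _ AB H I3 I4) as N.
  rewrite norm_C_R in N.
  eapply Rle_trans; [apply N|].
  - intros x Hx. rewrite norm_C_R.
    apply Rle_trans with (Cmod (RtoC (poisson e x) * (F x - c))%C).
    { right; f_equal; apply injective_projections; simpl; unfold minus, plus, opp; simpl;
        unfold plus, opp; simpl; ring. }
    pose proof (poisson_pos e x He) as Hp. pose proof (poisson_mult_sq e x He) as Hq.
    rewrite Cmod_mult, Cmod_R, Rabs_right by lra.
    unfold plus, scal; simpl. unfold mult; simpl.
    specialize (HF x Hx).
    apply Rmult_le_compat_l with (r := poisson e x) in HF; [|lra].
    apply Rmult_le_compat_l with (r := L) in Hq; [|lra].
    simpl in *. lra.
  - unfold plus, scal; simpl. unfold mult; simpl.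
    pose proof (poisson_mass_le e A B). nra.
Qed.

(** * The cofactor of the Poisson kernel *)

(** The quotient of [B (e + ix, e - ix)] by the Poisson kernel, in a form that
    makes sense at [e = 0]. *)
Definition poisson_cofactor (e x : R) : C :=
  (RtoC ((2 * e + 1) * raise_factor (1 + e) x) * shifted_beta e x)%C.

Lemma Beta_near_imag_poisson (e x : R) : 0 < e ->
  Beta_near_imag e x = (RtoC (poisson e x) * poisson_cofactor e x)%C.
Proof.
  intros He. rewrite Beta_near_imag_shifted by exact He. unfold poisson_cofactor.
  rewrite Cmult_assoc, <- RtoC_mult. f_equal. f_equal. unfold poisson, raise_factor.
  field. nra.
Qed.

Lemma poisson_cofactor_continuous (e x : R) : 0 < e ->
  @continuous R_UniformSpace C_UniformSpace (poisson_cofactor e) x.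
Proof.
  intros He. unfold poisson_cofactor.
  apply (filterlim_Cmult_fct (fun x => RtoC ((2 * e + 1) * raise_factor (1 + e) x)) (shifted_beta e)).
  - apply filterlim_RtoC_fct.
    apply (ex_derive_continuous (K := R_AbsRing) (V := R_NormedModule)
      (fun x => (2 * e + 1) * raise_factor (1 + e) x)).
    unfold raise_factor. auto_derive. nra.
  - apply filterlim_Cmod. intros eta Heta.
    assert (H2 : 0 < eta / 2) by lra.
    exists (mkposreal _ H2). intros y Hy. change (Rabs (y - x) < eta / 2) in Hy.
    eapply Rle_lt_trans; [apply shifted_beta_lipschitz; lra|].
    rewrite Rminus_diag, Rabs_R0. lra.
Qed.

(** For [e < 1] the three factors of the numerator are at most 3, 4 and 5,
    and the denominator is at least 1. *)
Lemma Cmod_poisson_cofactor_le (e x : R) : 0 < e < 1 -> Cmod (poisson_cofactor e x) <= 60.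
Proof.
  intros He. unfold poisson_cofactor. rewrite Cmod_mult, Cmod_R.
  pose proof (Cmod_shifted_beta_le e x ltac:(lra)). pose proof (Cmod_ge_0 (shifted_beta e x)).
  assert (HD : 1 <= (1 + e) ^ 2 + x ^ 2) by nra.
  assert (HR : 0 <= raise_factor (1 + e) x <= 20).
  { unfold raise_factor. split.
    - apply Rmult_le_pos; [nra|]. left; apply Rinv_0_lt_compat; lra.
    - apply Rmult_le_reg_r with ((1 + e) ^ 2 + x ^ 2); [lra|].
      unfold Rdiv. rewrite Rmult_assoc, Rinv_l, Rmult_1_r by lra. nra. }
  rewrite Rabs_right by nra.
  assert (0 <= (2 * e + 1) * raise_factor (1 + e) x <= 60) by nra. nra.
Qed.

(** The rational factor tends to 6, the beta factor to [B (2, 2) = 1 / 6]. *)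
Lemma poisson_cofactor_lim :
  filterlim (fun p => poisson_cofactor (fst p) (snd p)) (filter_prod (at_right 0) (locally 0))
    (@locally C_UniformSpace (RtoC 1)).
Proof.
  unfold poisson_cofactor.
  replace (RtoC 1) with (RtoC (6 * / (1 + 0)) * shifted_beta 0 0)%C.
  2: { rewrite shifted_beta_0_0, <- RtoC_mult. f_equal. field. }
  assert (FR : forall (f : R -> R) l, ex_derive f 0 -> f 0 = l ->
    filterlim (fun p : R * R => f (fst p)) (filter_prod (at_right 0) (locally 0)) (locally l)).
  { intros f l Hf <-. apply (filterlim_comp _ _ _ fst f _ (at_right 0)); [apply filterlim_fst|].
    apply (filterlim_filter_le_1 f (filter_le_within (F := locally 0) _)).
    apply (ex_derive_continuous (K := R_AbsRing) (V := R_NormedModule)), Hf. }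
  apply (filterlim_Cmult_fct (fun p => RtoC ((2 * fst p + 1) * raise_factor (1 + fst p) (snd p)))
    (fun p => shifted_beta (fst p) (snd p))).
  - apply filterlim_RtoC_fct.
    apply (filterlim_ext (fun p =>
      (fun e => (2 * e + 1) * (2 * (1 + e) * (2 * (1 + e) + 1))) (fst p) *
      / ((fun e => (1 + e) ^ 2) (fst p) + snd p ^ 2))).
    { intros [e x]. unfold raise_factor. simpl. unfold Rdiv. ring. }
    apply filterlim_Rmult_fct.
    + apply (FR (fun e => (2 * e + 1) * (2 * (1 + e) * (2 * (1 + e) + 1)))); [|ring].
      auto_derive. exact I.
    + apply (filterlim_comp _ _ _ (fun p : R * R => (fun e => (1 + e) ^ 2) (fst p) + snd p ^ 2)
        Rinv _ (locally (1 + 0))).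
      * apply filterlim_Rplus_fct.
        -- apply (FR (fun e => (1 + e) ^ 2)); [|ring]. auto_derive. exact I.
        -- apply (filterlim_comp _ _ _ snd (fun x => x ^ 2) _ (locally 0)); [apply filterlim_snd|].
           replace 0 with (0 ^ 2) at 2 by ring.
           apply (ex_derive_continuous (K := R_AbsRing) (V := R_NormedModule) (fun x => x ^ 2)).
           auto_derive. exact I.
      * apply (ex_derive_continuous (K := R_AbsRing) (V := R_NormedModule) Rinv).
        auto_derive. lra.
  - apply filterlim_Cmod. intros eta Heta.
    assert (H4 : 0 < eta / 4) by lra.
    exists (fun e => 0 < e < eta / 4) (fun x => Rabs x < eta / 4).
    + exists (mkposreal _ H4). intros e Hb He. apply Rabs_lt_between' in Hb. simpl in Hb. lra.
    + exists (mkposreal _ H4). intros x Hb. change (Rabs (x - 0) < eta / 4) in Hb.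
      rewrite Rminus_0_r in Hb. exact Hb.
    + intros e x He Hx. simpl. eapply Rle_lt_trans; [apply shifted_beta_lipschitz; lra|].
      rewrite !Rminus_0_r, (Rabs_right e) by lra. lra.
Qed.

(** * The weak limit *)

Lemma at_right_0_lt (d : R) : 0 < d -> at_right 0 (fun e => 0 < e < d).
Proof.
  intros Hd. exists (mkposreal d Hd). intros e Hb He.
  apply Rabs_lt_between' in Hb. simpl in Hb. lra.
Qed.

Lemma clamp_bounded (A B : R) (phi : R -> C) : A <= B -> continuous_on_segment A B phi ->
  exists M, 0 <= M /\ forall x, A <= x <= B -> Cmod (phi (clamp A B x)) <= M.
Proof.
  intros AB Hphi.
  destruct (bounded_continuity (V := C_R_NormedModule) (fun x => phi (clamp A B x)) A B) as [M HM].
  { intros x _. exact (continuous_clamp A B phi AB Hphi x). }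
  exists M.
  assert (HM' : forall x, A <= x <= B -> Cmod (phi (clamp A B x)) <= M).
  { intros x Hx. left. rewrite <- norm_C_R. apply HM; exact Hx. }
  split; [|exact HM'].
  eapply Rle_trans; [apply Cmod_ge_0|apply (HM' A); lra].
Qed.

Lemma integrand_poisson (e A B x : R) (phi : R -> C) : 0 < e -> A <= x <= B ->
  (phi x * Beta_near_imag e x)%C =
  (RtoC (poisson e x) * (phi (clamp A B x) * poisson_cofactor e x))%C.
Proof.
  intros He Hx. rewrite clamp_id, Beta_near_imag_poisson by assumption. ring.
Qed.

Lemma pairing_poisson (e A B : R) (phi : R -> C) : 0 < e -> A <= B ->
  pairing (Beta_near_imag e) A B phi =
  @RInt C_R_CompleteNormedModule
    (fun x => RtoC (poisson e x) * (phi (clamp A B x) * poisson_cofactor e x))%C A B.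
Proof.
  intros He AB. unfold pairing. apply (@RInt_ext C_R_CompleteNormedModule).
  rewrite Rmin_left, Rmax_right by exact AB. intros x Hx.
  apply integrand_poisson; lra.
Qed.

Lemma clamp_poisson_cofactor_continuous (e A B : R) (phi : R -> C) : 0 < e -> A <= B ->
  continuous_on_segment A B phi ->
  forall x, @continuous R_UniformSpace C_UniformSpace
    (fun x => phi (clamp A B x) * poisson_cofactor e x)%C x.
Proof.
  intros He AB Hphi x.
  apply (filterlim_Cmult_fct (fun x => phi (clamp A B x)) (poisson_cofactor e)).
  - exact (continuous_clamp A B phi AB Hphi x).
  - exact (poisson_cofactor_continuous e x He).
Qed.

Lemma ex_RInt_pairing (e A B : R) (phi : R -> C) : 0 < e -> A <= B ->
  continuous_on_segment A B phi ->
  @ex_RInt C_R_NormedModule (fun x => (phi x * Beta_near_imag e x)%C) A B.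
Proof.
  intros He AB Hphi.
  apply (@ex_RInt_ext C_R_NormedModule
    (fun x => (RtoC (poisson e x) * (phi (clamp A B x) * poisson_cofactor e x))%C)).
  { rewrite Rmin_left, Rmax_right by exact AB. intros x Hx.
    symmetry. apply integrand_poisson; lra. }
  apply (@ex_RInt_continuous C_R_CompleteNormedModule). intros x _.
  apply (filterlim_Cmult_fct (fun x => RtoC (poisson e x))
    (fun x => phi (clamp A B x) * poisson_cofactor e x)%C).
  - apply filterlim_RtoC_fct. apply continuous_poisson; exact He.
  - exact (clamp_poisson_cofactor_continuous e A B phi He AB Hphi x).
Qed.

Lemma Cmod_clamp_poisson_cofactor_le (e A B x M : R) (phi : R -> C) : 0 < e < 1 ->
  Cmod (phi (clamp A B x)) <= M -> Cmod (phi (clamp A B x) * poisson_cofactor e x)%C <= 60 * M.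
Proof.
  intros He HM. rewrite Cmod_mult.
  pose proof (Cmod_poisson_cofactor_le e x He). pose proof (Cmod_ge_0 (poisson_cofactor e x)).
  pose proof (Cmod_ge_0 (phi (clamp A B x))). nra.
Qed.

(** On the segment [x^2] is bounded below by some [d > 0], so that a bound [M'] for the
    integrand without the Poisson kernel is at most [(M' / d) x^2]: the estimate
    applies with [c = 0] and [eta = 0]. *)
Lemma pairing_lim_0 (A B : R) (phi : R -> C) : A < B -> continuous_on_segment A B phi ->
  ~ (A <= 0 <= B) ->
  filterlim (fun e => pairing (Beta_near_imag e) A B phi) (at_right 0)
    (@locally C_UniformSpace (RtoC 0)).
Proof.
  intros AB Hphi H0.
  destruct (clamp_bounded A B phi (Rlt_le _ _ AB) Hphi) as [M [HM0 HM]].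
  assert (Hd : exists d, 0 < d /\ forall x, A <= x <= B -> d <= x ^ 2).
  { destruct (Rlt_dec 0 A) as [HA|HA].
    - exists (A ^ 2). split; [nra|]. intros; nra.
    - exists (B ^ 2). split; [|intros; nra]. assert (B < 0) by (apply Rnot_le_lt; intros C; apply H0; lra). nra. }
  destruct Hd as [d [Hd Hdx]].
  apply filterlim_Cmod. intros eta Heta.
  set (L := 60 * M / d).
  assert (HL : 0 <= L) by (apply Rmult_le_pos; [lra|left; apply Rinv_0_lt_compat; lra]).
  assert (HLB : 0 < 2 * L * (B - A) + 1) by nra.
  generalize (at_right_0_lt (Rmin 1 (eta / (2 * L * (B - A) + 1)))
    (Rmin_pos _ _ Rlt_0_1 (Rdiv_lt_0_compat _ _ Heta HLB))).
  apply filter_imp. intros e He.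
  pose proof (Rmin_l 1 (eta / (2 * L * (B - A) + 1))).
  pose proof (Rmin_r 1 (eta / (2 * L * (B - A) + 1))).
  rewrite pairing_poisson by lra.
  pose proof (poisson_integral_estimate e A B 0 L (fun x => phi (clamp A B x) * poisson_cofactor e x)%C (RtoC 0)
    ltac:(lra) ltac:(lra) ltac:(lra) HL (clamp_poisson_cofactor_continuous e A B phi (proj1 He) (Rlt_le _ _ AB) Hphi)) as E.
  rewrite Cmult_0_r in E.
  eapply Rle_lt_trans; [apply E|].
  - intros x Hx. replace (phi (clamp A B x) * poisson_cofactor e x - RtoC 0)%C
      with (phi (clamp A B x) * poisson_cofactor e x)%C by ring.
    eapply Rle_trans; [apply (Cmod_clamp_poisson_cofactor_le e A B x M); [lra|apply HM, Hx]|].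
    rewrite Rplus_0_l. replace (60 * M) with (L * d) by (unfold L; field; lra).
    apply Rmult_le_compat_l; [exact HL|apply Hdx, Hx].
  - assert (He' : e < eta / (2 * L * (B - A) + 1)) by lra.
    apply Rmult_lt_compat_r with (r := 2 * L * (B - A) + 1) in He'; [|exact HLB].
    replace (eta / (2 * L * (B - A) + 1) * (2 * L * (B - A) + 1)) with eta in He' by (field; lra).
    lra.
Qed.

(** Within [d] of 0 the product of [phi] and the cofactor is close to [phi 0];
    farther away its distance to [phi 0] is bounded, hence at most [L x^2] with
    [L] the bound divided by [d^2]. *)
Lemma pairing_lim_delta (A B : R) (phi : R -> C) : continuous_on_segment A B phi -> A < 0 < B ->
  filterlim (fun e => pairing (Beta_near_imag e) A B phi) (at_right 0)
    (@locally C_UniformSpace (RtoC (2 * PI) * phi 0)%C).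
Proof.
  intros Hphi H0. assert (AB : A <= B) by lra.
  destruct (clamp_bounded A B phi AB Hphi) as [M [HM0 HM]].
  set (c := phi 0).
  assert (JL : filterlim (fun p => phi (clamp A B (snd p)) * poisson_cofactor (fst p) (snd p))%C
     (filter_prod (at_right 0) (locally 0)) (@locally C_UniformSpace c)).
  { replace c with (c * RtoC 1)%C by ring.
    apply (filterlim_Cmult_fct (fun p => phi (clamp A B (snd p))) (fun p => poisson_cofactor (fst p) (snd p)));
      [|exact poisson_cofactor_lim].
    apply (filterlim_comp _ _ _ snd (fun x => phi (clamp A B x)) _ (locally 0));
      [apply filterlim_snd|].
    unfold c. rewrite <- (clamp_id A B 0) at 2 by lra.
    exact (continuous_clamp A B phi AB Hphi 0). }
  apply filterlim_Cmod. intros eta Heta.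
  (* The three error terms are kept below eta / 2, eta / 4 and eta / 4; the
     first is 2 PI times eta / 16, and PI <= 4. *)
  destruct (proj1 (filterlim_Cmod _ _) JL (eta / 16) ltac:(lra)) as [Q S HQ [d HS] HQS].
  simpl in HQS.
  pose proof (Cmod_ge_0 c) as Hc0.
  pose proof (cond_pos d) as Hd.
  set (L := (60 * M + Cmod c) / d ^ 2).
  assert (Hd2 : 0 < d ^ 2) by (apply pow_lt; exact Hd).
  assert (HL : 0 <= L) by (apply Rmult_le_pos; [lra|left; apply Rinv_0_lt_compat; lra]).
  assert (HLB : 0 < 8 * (L * (B - A) + 1)) by nra.
  assert (Hm : at_right 0 (fun e => Rabs (poisson_mass e A B - 2 * PI) < eta / (4 * (Cmod c + 1)))).
  { assert (Hp : 0 < eta / (4 * (Cmod c + 1))) by (apply Rdiv_lt_0_compat; lra).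
    exact (poisson_mass_lim A B H0 _ (locally_ball (2 * PI) (mkposreal _ Hp))). }
  generalize (filter_and _ _ (filter_and _ _ HQ Hm)
    (at_right_0_lt (Rmin 1 (eta / (8 * (L * (B - A) + 1))))
    (Rmin_pos _ _ Rlt_0_1 (Rdiv_lt_0_compat _ _ Heta HLB)))).
  apply filter_imp. intros e [[HeQ Hem] He].
  pose proof (Rmin_l 1 (eta / (8 * (L * (B - A) + 1)))) as Hmin1.
  pose proof (Rmin_r 1 (eta / (8 * (L * (B - A) + 1)))) as Hmin2.
  rewrite pairing_poisson by lra.
  pose proof (poisson_integral_estimate e A B (eta / 16) L (fun x => phi (clamp A B x) * poisson_cofactor e x)%C c
    ltac:(lra) ltac:(lra) ltac:(lra) HL (clamp_poisson_cofactor_continuous e A B phi (proj1 He) AB Hphi)) as E.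
  set (I := RInt _ _ _) in *.
  replace (I - RtoC (2 * PI) * c)%C with
    ((I - RtoC (poisson_mass e A B) * c) + RtoC (poisson_mass e A B - 2 * PI) * c)%C
    by (rewrite RtoC_minus; ring).
  eapply Rle_lt_trans; [apply Cmod_triangle|].
  rewrite Cmod_mult, Cmod_R.
  assert (E2 : Rabs (poisson_mass e A B - 2 * PI) * Cmod c <= eta / 4).
  { apply Rle_trans with (eta / (4 * (Cmod c + 1)) * (Cmod c + 1)).
    - apply Rmult_le_compat; [apply Rabs_pos|exact Hc0|lra|lra].
    - right; field; lra. }
  assert (E1 : 2 * e * L * (B - A) < eta / 4).
  { assert (He' : e < eta / (8 * (L * (B - A) + 1))) by lra.
    apply Rmult_lt_compat_r with (1 := HLB) in He'.
    replace (eta / (8 * (L * (B - A) + 1)) * (8 * (L * (B - A) + 1))) with eta in He'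
      by (field; lra).
    lra. }
  assert (E3 : 2 * PI * (eta / 16) <= eta / 2).
  { pose proof PI_4. nra. }
  enough (E0 : forall x, A <= x <= B ->
     Cmod (phi (clamp A B x) * poisson_cofactor e x - c)%C <= eta / 16 + L * x ^ 2).
  { specialize (E E0). lra. }
  intros x Hx. destruct (Rlt_dec (Rabs x) d) as [Hxd|Hxd].
  - assert (HSx : S x).
    { apply HS. change (Rabs (x - 0) < d). rewrite Rminus_0_r. exact Hxd. }
    specialize (HQS e x HeQ HSx). pose proof (pow2_ge_0 x). nra.
  - assert (Hx2 : d ^ 2 <= x ^ 2).
    { rewrite <- (pow2_abs x). apply pow_incr. lra. }
    eapply Rle_trans; [apply Cmod_triangle|]. rewrite Cmod_opp.
    pose proof (Cmod_clamp_poisson_cofactor_le e A B x M phi ltac:(lra) (HM x Hx)).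
    apply Rle_trans with (L * d ^ 2).
    + replace (L * d ^ 2) with (60 * M + Cmod c) by (unfold L; field; lra). lra.
    + apply Rmult_le_compat_l with (r := L) in Hx2; lra.
Qed.

Theorem mainTheorem1 :
  gf_eq Beta_imag (gf_scal (RtoC (2 * PI)) dirac_delta) /\
  (forall (A B : R) (phi : R -> C),
    A < B -> continuous_on_segment A B phi ->
    (A < 0 < B ->
      filterlim
        (fun eps : R =>
          @RInt C_R_CompleteNormedModule
            (fun x : R =>
              (phi x * Beta (RtoC eps + Ci * RtoC x) (RtoC eps - Ci * RtoC x))%C)
            A B)
        (at_right 0) (@locally C_UniformSpace (RtoC (2 * PI) * phi 0)%C)) /\
    (~ (A <= 0 <= B) ->
      filterlim
        (fun eps : R =>
          @RInt C_R_CompleteNormedModule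
            (fun x : R =>
              (phi x * Beta (RtoC eps + Ci * RtoC x) (RtoC eps - Ci * RtoC x))%C)
            A B)
        (at_right 0) (@locally C_UniformSpace (RtoC 0)))).
Proof.
  split.
  - intros A B phi AB HA HB Hphi v.
    (* As 0 is not an endpoint, the limit always exists and is the value
       of the delta functional, so the equivalence is uniqueness of limits. *)
    assert (EI : forall e, 0 < e ->
      @ex_RInt C_R_NormedModule (fun x => (phi x * Beta_near_imag e x)%C) A B).
    { intros e He. apply ex_RInt_pairing; [exact He|lra|exact Hphi]. }
    split.
    + intros [_ Hv].
      destruct (Rlt_dec A 0) as [HA0|HA0]; [destruct (Rlt_dec 0 B) as [HB0|HB0]|].
      * exists (phi 0). split; [left; split; [lra|reflexivity]|].
        exact (filterlim_locally_unique (V := C_R_NormedModule) _ _ _ Hv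
          (pairing_lim_delta A B phi Hphi (conj HA0 HB0))).
      * assert (H0 : ~ (A <= 0 <= B)) by lra.
        exists (RtoC 0). split; [right; split; [exact H0|reflexivity]|].
        rewrite Cmult_0_r.
        exact (filterlim_locally_unique (V := C_R_NormedModule) _ _ _ Hv
          (pairing_lim_0 A B phi AB Hphi H0)).
      * assert (H0 : ~ (A <= 0 <= B)) by lra.
        exists (RtoC 0). split; [right; split; [exact H0|reflexivity]|].
        rewrite Cmult_0_r.
        exact (filterlim_locally_unique (V := C_R_NormedModule) _ _ _ Hv
          (pairing_lim_0 A B phi AB Hphi H0)).
    + intros [w [[[H0 ->]|[H0 ->]] ->]]; split; try exact EI.
      * exact (pairing_lim_delta A B phi Hphi H0).
      * rewrite Cmult_0_r. exact (pairing_lim_0 A B phi AB Hphi H0).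
  - intros A B phi AB Hphi. split; intros H0.
    + exact (pairing_lim_delta A B phi Hphi H0).
    + exact (pairing_lim_0 A B phi AB Hphi H0).
Qed.
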